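(* Let $\lambda\in(0,\infty)$, let $p_n=\lambda/n$, and let $G_n$ be the Erdős–Rényi random graph $G(n,p_n)$. Then, as $n\to\infty$, for $q=q_n\in\{1,\dots,n\}$, $$\mathbb{P}(V_T(G_n)\ge q)=\frac{n(n-1)\times\cdots\times(n-q+1)}{(3!)^{q/3}\,(q/3)!}\,p_n^{q}\,\mathrm{e}^{o(n^{19/20})}.$$ In particular, for $a\in(0,1)$, $$\log\mathbb{P}(V_T(G_n)\ge an)=-n(1-a)\log(1-a)-\tfrac13 an\,\log(\tfrac13 an)-an\left(\tfrac23+\tfrac13\log 6\right)+an\log\lambda+o(n^{19/20}).$$
   Context: $G(n,p)$ is the random simple graph on vertex set $[n]=\{1,\dots,n\}$ in which each of the $\binom n2$ possible edges is present independently with probability $p$ (with $p_n=\lambda/n$, take $n\geq\lambda$). For a graph $G$, $V_T(G)$ is the number of vertices of $G$ that belong to at least one triangle of $G$. For real $x\ge0$, $x!$ means $\Gamma(x+1)$. *)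

(* Defs.v *)
From HB Require Import structures.
From mathcomp Require Import all_boot all_order all_algebra.
From mathcomp Require Import all_classical all_reals all_analysis.

Set Implicit Arguments.
Unset Strict Implicit.
Unset Printing Implicit Defensive.

Import Order.TTheory GRing.Theory Num.Theory.
Import numFieldNormedType.Exports.

Local Open Scope ring_scope.

(* An edge is a possible edge (an unordered pair of distinct vertices), so that
   a simple graph on 'I_n is exactly a subset of [edge n]. *)
Definition edge (n : nat) := {e : {set 'I_n} | #|e| == 2%N}.

Definition sgraph (n : nat) := {set edge n}.

Definition triangle (n : nat) (G : sgraph n) (T : {set 'I_n}) : bool :=
  (#|T| == 3%N) && [forall e : edge n, (val e \subset T) ==> (e \in G)].

Definition VT (n : nat) (G : sgraph n) : nat :=
  #|[set v : 'I_n | [exists T : {set 'I_n}, (v \in T) && triangle G T]]|.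

Definition Gnp_weight (R : realType) (n : nat) (p : R) (G : sgraph n) : R :=
  \prod_(e : edge n) (if e \in G then p else 1 - p).

(* P(G(n,p) satisfies A); a probability when 0 <= p <= 1. *)
Definition Gnp_prob (R : realType) (n : nat) (p : R) (A : pred (sgraph n)) : R :=
  \sum_(G : sgraph n | A G) Gnp_weight p G.

(* The edge indicators are independent Bernoulli(p) variables. *)
Lemma Gnp_prob_edges (R : realType) (n : nat) (p : R) (A : {set edge n}) :
  Gnp_prob p (fun G => A \subset G) = p ^+ #|A|.
Proof.
rewrite /Gnp_prob.
transitivity (\prod_(e : edge n) (p + (if e \in A then 0 else 1 - p))); last first.
  rewrite (bigID (mem A)) /= [X in _ * X]big1 ?mulr1; last first.
    by move=> e /negbTE ->; rewrite addrC subrK.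
  rewrite -prodr_const; apply: eq_bigr => e /= ->; exact: addr0.
rewrite bigA_distr big_mkcond /=; apply: eq_bigr => G _.
case: ifPn => [AG|/fintype.subsetPn[e eA eG]].
  apply: eq_bigr => e _; case: ifPn => // eG.
  by case: ifPn => // eA; rewrite (fintype.subsetP AG) in eG.
by symmetry; apply/eqP/prodf_eq0; exists e => //; rewrite (negbTE eG) eA.
Qed.

Lemma Gnp_probT (R : realType) (n : nat) (p : R) :
  Gnp_prob p (fun _ : sgraph n => true) = 1.
Proof.
rewrite -[RHS](expr0 p) -(cards0 (edge n)) -Gnp_prob_edges.
by apply: eq_bigl => G; rewrite finset.sub0set.
Qed.

Definition Gamma (R : realType) (x : R) : R :=
  \int[lebesgue_measure]_(t in `]0, +oo[) (t `^ (x - 1) * expR (- t)).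

Definition rfact (R : realType) (x : R) : R := Gamma (x + 1).

(* Main.v *)
Require Import Defs.
From mathcomp Require Import all_boot all_order all_algebra.
From mathcomp Require Import all_classical all_reals all_analysis.
From mathcomp Require Import measurable_realfun.
From mathcomp Require Import ring lra zify.

Import Order.TTheory GRing.Theory Num.Theory.
Import numFieldNormedType.Exports.

Local Open Scope classical_set_scope.
Local Open Scope ring_scope.

(** Write [p = lambda / n].  The cheapest way to put [3 k] vertices into
    triangles is to plant [k] vertex-disjoint triangles.  There are
    [n ^_ (3 k) / (6 ^ k * k!)] families of [k] disjoint triples
    ([card_packings]), each of them is present with probability [p ^ (3 k)], and
    the formula of the theorem interpolates this first moment at [k = q / 3].
    The proof compares both the probability and the formula with [expR (rate)],
    where [rate] is the logarithm of the first moment with every factorial [x!]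
    replaced by [x ^ x * e ^ - x].

    Lower bound.  Conditionally on a given family of [k] disjoint triangles, the
    expected number of further triangles is bounded, because every other triple
    needs at least two new edges ([new_edges_packing], [sum_new_edges]).  By
    Markov's inequality, with conditional probability at least 1/2 there are at
    most [s] of them, with [s] constant, and then the graph contains only
    [(n + s) ^ s] families of [k] triangles.  So the first moment overestimates
    the probability by a polynomial factor only ([VT_prob_ge]).  The remainder
    of [q] modulo 3 is dealt with by adding one triangle at a time, at
    polynomial cost ([VT_prob_succ]).

    Upper bound.  Take a maximal family of disjoint triangles, of size [k], and
    cover the remaining vertices of triangles by a minimal family of [j] other
    triangles.  By maximality each of the latter adds at most two vertices, so
    that [q <= 3 k + 2 j]; by minimality each of them has a private vertex, hence
    brings at least two new edges in whichever order they are revealed.  The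
    first moment of such families is at most that of the disjoint ones times
    [C ^ j / j!], with a constant [C] ([sum_private_le], [VT_prob_le]).

    It remains to see that nothing is gained with [j] large.  Write
    [d = q - 3 k <= 2 j] for the number of vertices that the disjoint triangles
    do not cover.  If [d <= n ^ (9/10)], everything involved has size
    [n ^ (O(d))], that is [expR] of [O (n ^ (9/10) * ln n)].  If [d] is larger,
    then dropping [d / 3] disjoint triangles multiplies the first moment by at
    most about [n ^ (4 d / 3) / d ^ d], while [j!] gives back [d ^ (d / 2)]; since
    [4/3 < 3/2 * 9/10] the product is less than 1 ([rate_drop_large]).  The total
    error is [O (n ^ (9/10) * ln n)], which is [o (n ^ (19/20))]. *)

Set Implicit Arguments.
Unset Strict Implicit.

(** * Triangles and edges, and the law of the random graph *)

Section Graphs.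
Import boot.fintype boot.finset.
Local Close Scope classical_set_scope.

(** Double counting of the pairs of a set of [k + 1] elements and one of its
    members.  Iterating it is how a sum over unordered families acquires its
    factor [1 / k!]. *)
Lemma sum_card_succ (V : nmodType) (T : finType) (k : nat) (f : {set T} -> V) :
  (\sum_(X : {set T} | #|X| == k.+1) f X) *+ k.+1 =
  \sum_(Y : {set T} | #|Y| == k) \sum_(t | t \notin Y) f (t |: Y).
Proof.
transitivity (\sum_(X : {set T} | #|X| == k.+1) \sum_(t in X) f X).
  rewrite -sumrMnl; apply: eq_bigr => X /eqP cX.
  by rewrite sumr_const cX.
rewrite (exchange_big_dep predT) //= [RHS](exchange_big_dep predT) //=.
apply: eq_bigr => t _.
rewrite [RHS](reindex_onto (fun X => X :\ t) (fun Y => t |: Y)) /=; last first.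
  by move=> Y /andP[_ tY]; rewrite setU1K.
apply: eq_big => [X|X /andP[_ tX]]; last by rewrite setD1K.
have [tX|tX] := boolP (t \in X).
  by rewrite setD1K // eqxx !andbT setD11 /= (cardsD1 t X) tX andbT.
rewrite andbF; apply/esym/negP => /andP[_ /eqP e].
by move: tX; rewrite -e setU11.
Qed.

Lemma card_bigcup_le (T I : finType) (P : pred I) (A : I -> {set T}) :
  (#|\bigcup_(i | P i) A i| <= \sum_(i | P i) #|A i|)%N.
Proof.
elim/big_rec2: _ => [|i m U _ leUm]; first by rewrite cards0.
by rewrite (leq_trans (leq_card_setU _ _).1) ?leq_add2l.
Qed.

Variable n : nat.

Definition edges_in (t : {set 'I_n}) : {set edge n} := [set e : edge n | val e \subset t].

Definition edges_of (F : {set {set 'I_n}}) : {set edge n} :=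
  \bigcup_(t in F) edges_in t.

Definition triples : {set {set 'I_n}} := [set t : {set 'I_n} | #|t| == 3%N].

Definition triangles (G : sgraph n) : {set {set 'I_n}} := [set t : {set 'I_n} | triangle G t].

Lemma in_triangles G t :
  (t \in triangles G) = (t \in triples) && (edges_in t \subset G).
Proof.
rewrite !inE /triangle; congr (_ && _); apply/forallP/subsetP.
  by move=> h e; rewrite inE => et; have /implyP/(_ et) := h e.
by move=> h e; apply/implyP => et; apply: h; rewrite inE.
Qed.

Lemma sub_triangles G (F : {set {set 'I_n}}) :
  (F \subset triangles G) = (F \subset triples) && (edges_of F \subset G).
Proof.
apply/subsetP/andP.
  move=> h; split; first by apply/subsetP => t /h; rewrite in_triangles => /andP[].
  by apply/bigcupsP => t /h; rewrite in_triangles => /andP[].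
move=> [/subsetP h1 /bigcupsP h2] t tF.
by rewrite in_triangles h1 // h2.
Qed.

Lemma VT_cover G : VT G = #|cover (triangles G)|.
Proof.
rewrite /VT; apply: eq_card => v; rewrite inE; apply/existsP/bigcupP.
  by case=> T /andP[vT tT]; exists T => //; rewrite inE.
by case=> T; rewrite inE => tT vT; exists T; rewrite vT.
Qed.

Lemma edges_ofU1 t F : edges_of (t |: F) = edges_in t :|: edges_of F.
Proof. by rewrite /edges_of bigcup_setU big_set1. Qed.

Lemma card_edges_in (t : {set 'I_n}) : #|edges_in t| = 'C(#|t|, 2).
Proof.
rewrite -cards_draws -(card_imset (mem (edges_in t)) val_inj).
apply: eq_card => A; rewrite !inE; apply/imsetP/andP.
  by case=> e; rewrite inE => h ->; split => //; apply: (valP e).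
by case=> At cA; exists (exist _ A cA); rewrite ?inE.
Qed.

Lemma card_edges_in3 (t : {set 'I_n}) : t \in triples -> #|edges_in t| = 3%N.
Proof. by rewrite inE card_edges_in => /eqP ->. Qed.

Lemma card_edges_of (F : {set {set 'I_n}}) : F \subset triples -> (#|edges_of F| <= 3 * #|F|)%N.
Proof.
move=> /subsetP h; apply: leq_trans (card_bigcup_le _ _) _ => /=.
rewrite mulnC -sum_nat_const leq_sum // => t /h/card_edges_in3 -> //.
Qed.

Variable R : realType.

Section Prob.
Variable p : R.
Hypothesis p01 : 0 < p <= 1.

Let p_gt0 : 0 < p. Proof. by case/andP: p01. Qed.
Let p_ge0 : 0 <= p. Proof. exact: ltW. Qed.
Let p_le1 : p <= 1. Proof. by case/andP: p01. Qed.

Lemma Gnp_weight_ge0 (G : sgraph n) : 0 <= Gnp_weight p G.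
Proof. by apply: prodr_ge0 => e _; case: ifP => _; rewrite ?subr_ge0. Qed.

Lemma Gnp_prob_ge0 (A : pred (sgraph n)) : 0 <= Gnp_prob p A.
Proof. by apply: sumr_ge0 => G _; exact: Gnp_weight_ge0. Qed.

Lemma Gnp_prob_le (A B : pred (sgraph n)) :
  {subset A <= B} -> Gnp_prob p A <= Gnp_prob p B.
Proof.
move=> h; rewrite /Gnp_prob big_mkcond [leRHS]big_mkcond /=.
apply: ler_sum => G _; case: ifP => AG; last first.
  by case: ifP => // _; exact: Gnp_weight_ge0.
by have := h G AG; rewrite unfold_in => ->.
Qed.

Lemma Gnp_probE (A : pred (sgraph n)) :
  Gnp_prob p A = \sum_G Gnp_weight p G * (A G)%:R.
Proof.
rewrite /Gnp_prob big_mkcond; apply: eq_bigr => G _.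
by case: ifP => _; rewrite ?mulr1 ?mulr0.
Qed.

Lemma Gnp_prob_union (I : finType) (P : pred I) (A : pred (sgraph n))
    (B : I -> pred (sgraph n)) :
  (forall G, A G -> [exists i, P i && B i G]) ->
  Gnp_prob p A <= \sum_(i | P i) Gnp_prob p (B i).
Proof.
move=> h; rewrite Gnp_probE.
under [leRHS]eq_bigr do rewrite Gnp_probE.
rewrite exchange_big /=; apply: ler_sum => G _; rewrite -mulr_sumr.
apply: ler_wpM2l; first exact: Gnp_weight_ge0.
case AG: (A G); last by apply: sumr_ge0.
have /existsP[i /andP[Pi BiG]] := h G AG.
rewrite (bigD1 i) //= BiG lerDl; exact: sumr_ge0.
Qed.

(** Whether [A (e |: G)] holds does not depend on the presence of [e] in [G], so
    the left-hand side is the probability that [e] is present and [A] holds. *)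
Lemma Gnp_prob_add_edge (A : pred (sgraph n)) (e : edge n) :
  p * Gnp_prob p (fun G => A (e |: G)) <= Gnp_prob p A.
Proof.
have wU (G : sgraph n) : e \notin G ->
    p * (Gnp_weight p G + Gnp_weight p (e |: G)) = Gnp_weight p (e |: G).
  move=> eG; rewrite /Gnp_weight (bigD1 e) //= (negbTE eG).
  rewrite [\prod_(e0 : edge n) (if e0 \in e |: G then _ else _)](bigD1 e) //=.
  rewrite setU11.
  have -> : \prod_(i | i != e) (if i \in e |: G then p else 1 - p) =
            \prod_(i | i != e) (if i \in G then p else 1 - p).
    by apply: eq_bigr => i /negbTE ie; rewrite in_setU1 ie.
  by ring.
have split_e (f : sgraph n -> R) :
    \sum_G f G = \sum_(G : sgraph n | e \notin G) (f G + f (e |: G)).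
  rewrite (bigID (fun G : sgraph n => e \notin G)) /= big_split /=.
  congr (_ + _).
  rewrite [RHS](reindex_onto (fun X => X :\ e) (fun Y => e |: Y)) /=; last first.
    by move=> Y eY; rewrite setU1K.
  apply: eq_big => [X|X]; rewrite negbK; last by move=> eX; rewrite setD1K.
  rewrite setD11 /=; apply/idP/eqP => [eX|<-]; first by rewrite setD1K.
  exact: setU11.
rewrite !Gnp_probE !split_e mulr_sumr; apply: ler_sum => G eG.
rewrite setUA setUid -mulrDl mulrA wU // lerDr.
by rewrite mulr_ge0 // Gnp_weight_ge0.
Qed.

End Prob.
End Graphs.

(** * Vertex-disjoint triples *)

Section TriangleFamilies.
Import boot.fintype boot.finset.
Local Close Scope classical_set_scope.

Lemma bin_leq_exp (m k : nat) : ('C(m, k) <= m ^ k)%N.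
Proof.
apply: (@leq_trans (m ^_ k)); first by rewrite -bin_ffact leq_pmulr ?fact_gt0.
rewrite ffact_prod; apply: (@leq_trans (\prod_(i < k) m)).
  by apply: leq_prod => i _; rewrite leq_subr.
by rewrite prod_nat_const card_ord.
Qed.

Variable n : nat.
Implicit Types (F X Y : {set {set 'I_n}}) (t : {set 'I_n}) (G : sgraph n).

Lemma card_triples : #|triples n| = 'C(n, 3).
Proof. by rewrite card_draws card_ord. Qed.

Lemma exists_triple (v : 'I_n) : (3 <= n)%N -> exists2 t, t \in triples n & v \in t.
Proof.
move=> n3.
have : (0 < #|[set A : {set 'I_n} | A \subset ~: [set v] & #|A| == 2%N]|)%N.
  by rewrite cards_draws bin_gt0 cardsC1 card_ord; lia.
case/card_gt0P => A; rewrite inE => /andP[Av /eqP cA].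
exists (v |: A); last exact: setU11.
rewrite inE cardsU1 cA.
suff -> : v \notin A by [].
by apply/negP => /(subsetP Av); rewrite !inE eqxx.
Qed.

Definition packing F := (F \subset triples n) && trivIset F.

Lemma packing_sub F : packing F -> F \subset triples n. Proof. by case/andP. Qed.

Lemma packing_card_cover F : packing F -> #|cover F| = (3 * #|F|)%N.
Proof.
case/andP => /subsetP h /eqP <-; rewrite mulnC -sum_nat_const.
by apply: eq_bigr => t /h; rewrite inE => /eqP.
Qed.

Lemma packingU1 t F : t \notin F ->
  packing (t |: F) = [&& packing F, t \in triples n & t \subset ~: cover F].
Proof.
move=> tF; rewrite /packing subUset sub1set -disjoints_subset.
apply/andP/and3P.
  move=> [/andP[tt Ft] /trivIsetP h]; split=> //.
    rewrite Ft; apply/trivIsetP => A B AF BF; apply: h; exact: setU1r.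
  apply/bigcup_disjointP => A AF.
  apply: h; rewrite ?setU11 ?setU1r //; by apply: contraNneq tF => ->.
move=> [/andP[Ft Fi] tt /bigcup_disjointP dis].
split; first by rewrite tt Ft.
have h0 : set0 \notin F.
  by apply/negP => /(subsetP Ft); rewrite inE cards0.
by apply: (trivIsetU1 _ Fi h0).1 => A AF; apply: dis.
Qed.

(** A packing of size [k] extends by a triple in [C(n - 3 k, 3)] ways, and each
    packing of size [k + 1] arises [k + 1] times in this way. *)
Lemma card_packings k :
  (#|[set F | packing F & #|F| == k]| * (6 ^ k * k`!) = n ^_ (3 * k))%N.
Proof.
elim: k => [|k IH].
  rewrite muln0 ffactn0 expn0 fact0 !muln1.
  rewrite (_ : [set F | _ & _] = [set set0]) ?cards1 //.
  apply/setP => F; rewrite !inE cards_eq0; case: eqP => [->|]; last by rewrite andbF.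
  rewrite andbT /packing finset.sub0set; apply/trivIsetP => A B; by rewrite inE.
have sumE (m : nat) : #|[set F | packing F & #|F| == m]| =
    \sum_(F : {set {set 'I_n}} | #|F| == m) (packing F : nat).
  rewrite -sum1_card big_mkcond [in RHS]big_mkcond /=; apply: eq_bigr => F _.
  by rewrite inE; case: packing; case: ifP.
have step : (#|[set F | packing F & #|F| == k.+1]| * k.+1 =
    #|[set F | packing F & #|F| == k]| * 'C(n - 3 * k, 3))%N.
  transitivity ((\sum_(F : {set {set 'I_n}} | #|F| == k.+1) (packing F : nat)) *+ k.+1).
    by rewrite sumE -mulr_natr natn.
  rewrite sum_card_succ.
  rewrite sumE big_distrl /=; apply: eq_bigr => Y /eqP cY.
  have [pY|npY] := boolP (packing Y); last first.
    rewrite mul0n big1 // => t tY; by rewrite packingU1 // (negbTE npY).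
  rewrite mul1n -cY -packing_card_cover //.
  have -> : (n - #|cover Y|)%N = #|~: cover Y|.
    by have := cardsC (cover Y); rewrite card_ord; lia.
  rewrite -cards_draws -sum1_card big_mkcond [in RHS]big_mkcond /=.
  apply: eq_bigr => t _; rewrite inE.
  have [tY|tY] := boolP (t \in Y); last first.
    by rewrite packingU1 // pY /= inE andbC; case: ifP.
  case: ifP => // /andP[tc /eqP c3].
  have /card_gt0P[v vt] : (0 < #|t|)%N by rewrite c3.
  move/subsetP/(_ v vt): tc; rewrite inE => /negP[].
  by apply/bigcupP; exists t.
rewrite expnS factS mulnS addnC.
transitivity (#|[set F | packing F & #|F| == k]| * 'C(n - 3 * k, 3)
    * (6 * 6 ^ k * k`!))%N; first by rewrite -step; ring.
have -> : (n ^_ (3 * k + 3) = n ^_ (3 * k) * (n - 3 * k) ^_ 3)%N.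
  rewrite !addnS addn0 !ffactnSr ffactn0 mul1n !mulnA subn0.
  by rewrite -!subnDA addn1 addn2.
rewrite -IH -bin_ffact (_ : 3`! = 6)%N //; ring.
Qed.

Lemma disjoint_edges_in t F :
  t \subset ~: cover F -> [disjoint edges_in t & edges_of F].
Proof.
move=> /subsetP tc; apply/pred0P => e /=; apply/negP => /andP[].
rewrite inE => /subsetP et /bigcupP[s sF]; rewrite inE => /subsetP es.
have /card_gt0P[v ve] : (0 < #|val e|)%N by rewrite (eqP (valP e)).
have := tc _ (et _ ve); rewrite inE => /negP[].
by apply/bigcupP; exists s => //; apply: es.
Qed.

Lemma card_edges_of_packing F : packing F -> #|edges_of F| = (3 * #|F|)%N.
Proof.
move: {2}#|F| (erefl #|F|) => k; elim: k F => [|k IH] F cF pF.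
  by rewrite cF (cards0_eq cF) /edges_of big_set0 cards0.
have /card_gt0P[t tF] : (0 < #|F|)%N by rewrite cF.
have := cardsD1 t F; rewrite tF cF => -[/esym cF'].
move: pF; rewrite -(setD1K tF) packingU1 ?setD11 // => /and3P[pF' tt tc].
rewrite add0n in cF'.
rewrite edges_ofU1 cardsU (disjoint_setI0 (disjoint_edges_in tc)) cards0 subn0.
by rewrite IH // card_edges_in3 // cF'; lia.
Qed.

(** The two edges of [t] at the uncovered vertex [v] are both new. *)
Lemma new_edges_vertex t X (v : 'I_n) : t \in triples n -> v \in t ->
  v \notin cover X -> (2 <= #|edges_in t :\: edges_of X|)%N.
Proof.
move=> tt vt vX; rewrite cardsD card_edges_in3 //.
suff : (#|edges_in t :&: edges_of X| <= 1)%N by lia.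
apply: (@leq_trans #|edges_in (t :\ v)|); last first.
  rewrite card_edges_in; have := cardsD1 v t.
  by rewrite vt; move: tt; rewrite inE => /eqP -> [] ; rewrite add0n => <-.
apply/subset_leq_card/subsetP => e; rewrite !inE => /andP[et /bigcupP[s sX es]].
rewrite subsetD1 et /=; apply: contraNN vX => ve.
by apply/bigcupP; exists s => //; move: es; rewrite inE => /subsetP ->.
Qed.

(** Two edges of [t] share a vertex; if both lay inside members of the packing,
    these members would meet, hence coincide and contain all of [t]. *)
Lemma new_edges_packing t F : t \in triples n -> packing F -> t \notin F ->
  (2 <= #|edges_in t :\: edges_of F|)%N.
Proof.
move=> tt pF tF; rewrite cardsD card_edges_in3 //.
suff : (#|edges_in t :&: edges_of F| <= 1)%N by lia.
have [->|[e]] := set_0Vmem (edges_in t :&: edges_of F); first by rewrite cards0.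
rewrite !inE => /andP[et /bigcupP[s sF]]; rewrite inE => es.
have /eqP c3 : #|t| == 3%N by move: tt; rewrite inE.
have /eqP s3 : #|s| == 3%N.
  by have /packing_sub/subsetP/(_ s sF) := pF; rewrite inE.
apply: (@leq_trans #|edges_in (t :&: s)|); last first.
  rewrite card_edges_in; have : (#|t :&: s| < 3)%N.
    rewrite -c3 proper_card // properEneq subsetIl andbT.
    apply: contraNneq tF => /setIidPl ts; suff -> : t = s by [].
    by apply/eqP; rewrite eqEcard ts c3 s3.
  by case: #|_| => [|[|[|]]].
apply/subset_leq_card/subsetP => e'; rewrite !inE subsetI.
move=> /andP[e't /bigcupP[s' s'F]]; rewrite inE => e's'; rewrite e't /=.
suff <- : s' = s by [].
have /trivIsetP tri : trivIset F by case/andP: pF.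
apply: contraTeq isT => /(tri _ _ s'F sF)/disjoint_setI0 dis.
have : (#|val e' :&: val e| == 0)%N.
  by rewrite cards_eq0 -subset0 -dis setISS.
have := cardsUI (val e') (val e).
rewrite (eqP (valP e)) (eqP (valP e')) => h /eqP h0.
have : (#|val e' :|: val e| <= 3)%N by rewrite -c3 subset_leq_card // subUset e't.
by rewrite -(addn0 #|_ :|: _|) -[X in (_ + X)%N]h0 h.
Qed.

End TriangleFamilies.

(** * First moments of families of triangles *)

Section FirstMoments.
Import boot.fintype boot.finset.
Local Close Scope classical_set_scope.

Variables (R : realType) (n : nat) (p : R).
Hypothesis p01 : 0 < p <= 1.
Implicit Types (F X Y : {set {set 'I_n}}) (t : {set 'I_n}) (G : sgraph n).

Let p_gt0 : 0 < p. Proof. by case/andP: p01. Qed.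
Let p_ge0 : 0 <= p. Proof. exact: ltW. Qed.
Let p_le1 : p <= 1. Proof. by case/andP: p01. Qed.

(** A bound for the expected number of triangles with at least two random edges,
    given a graph with at most [6 n] edges.  It is the constant
    [lambda ^ 3 + 6 * lambda ^ 2] when [p = lambda / n]. *)
Definition extra_bound : R := (n%:R * p) ^+ 3 + 6 * (n%:R * p) ^+ 2.

Lemma extra_bound_ge0 : 0 <= extra_bound.
Proof. by rewrite addr_ge0 ?mulr_ge0 ?exprn_ge0 ?mulr_ge0. Qed.

Lemma card_triples_through_edge (e : edge n) :
  (#|[set t in triples n | val e \subset t]| <= n)%N.
Proof.
rewrite -[leqRHS](card_ord n) -cardsT.
apply: leq_trans (leq_imset_card (fun v => v |: val e) [set: 'I_n]).
apply/subset_leq_card/subsetP => t; rewrite !inE => /andP[/eqP c3 et].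
have : #|t :\: val e| = 1%N.
  by rewrite cardsD (setIidPr et) c3 (eqP (valP e)).
move/eqP/cards1P => [v tv]; apply/imsetP; exists v => //.
by rewrite -tv setDE setUIl [~: _ :|: _]setUC setUCr setIT; apply/esym/setUidPl.
Qed.

(** There are at most [n ^ 3] triples with three new edges, while a triple with
    only two is determined by its old edge and its third vertex.  The factor 6
    accounts for a packing and a further family of triples, each with at most [n]
    members of three edges. *)
Lemma sum_new_edges (H : {set edge n}) : (#|H| <= 6 * n)%N ->
  \sum_(t in triples n | (2 <= #|edges_in t :\: H|)%N) p ^+ #|edges_in t :\: H|
    <= extra_bound.
Proof.
move=> cH.
pose M := [set t in triples n | edges_in t :&: H != finset.set0].
have cM : (#|M| <= 6 * n * n)%N.
  apply: (@leq_trans (\sum_(e in H) #|[set t in triples n | val e \subset t]|)).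
    apply: leq_trans (card_bigcup_le _ _); apply/subset_leq_card/subsetP => t.
    rewrite inE => /andP[tt /set0Pn[e]]; rewrite inE => /andP[et eH].
    by apply/bigcupP; exists e => //; rewrite inE tt; rewrite inE in et.
  apply: (@leq_trans (\sum_(e in H) n)).
    by apply: leq_sum => e _; exact: card_triples_through_edge.
  by rewrite sum_nat_const leq_mul2r cH orbT.
apply: (@le_trans _ _ (\sum_(t in triples n) (p ^+ 3 + p ^+ 2 * (t \in M)%:R))).
  rewrite big_mkcondr /=; apply: ler_sum => t tt.
  case: ifP => h; last by rewrite addr_ge0 ?mulr_ge0 ?exprn_ge0.
  rewrite inE tt /=; case: eqP => [e0|_]; last first.
    rewrite mulr1 ler_wpDl ?exprn_ge0 //.
    by rewrite ler_wiXn2l.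
  by rewrite mulr0 addr0 cardsD e0 cards0 subn0 card_edges_in3.
rewrite big_split /= sumr_const -mulr_sumr.
rewrite /extra_bound !exprMn; apply: lerD.
  rewrite -[leLHS]mulr_natl -natrX ler_wpM2r ?exprn_ge0 // ler_nat card_triples.
  exact: bin_leq_exp.
rewrite mulrA mulrC ler_wpM2r ?exprn_ge0 //.
rewrite -natr_sum -natrX -natrM ler_nat; apply: leq_trans (leq_trans cM _); last by lia.
rewrite -sum1_card big_mkcond /= [leqRHS]big_mkcond /=.
by apply: leq_sum => t _; case: ifP => //; case: (t \in M).
Qed.

(** Each member of [X] has a vertex that neither [F] nor another member covers.
    Stated without reference to an order on [X], this passes to subfamilies. *)
Definition private F X :=
  [forall t in X, ~~ (t \subset cover F :|: cover (X :\ t))].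

Lemma privateU1 F Y t : t \notin Y -> private F (t |: Y) ->
  private F Y /\ ~~ (t \subset cover F :|: cover Y).
Proof.
move=> tY /forall_inP h; split; last by have := h _ (setU11 t Y); rewrite setU1K.
apply/forall_inP => s sY; apply: contra (h _ (setU1r _ sY)) => /subset_trans.
apply; apply: setUS; apply/bigcupsP => r; rewrite !inE => /andP[rs rY].
by apply: bigcup_sup; rewrite !inE rs rY orbT.
Qed.

(** The members of [X] are revealed one by one: each brings at least two new
    edges because of its private vertex, so that [sum_new_edges] bounds the
    contribution of the last one by [extra_bound], uniformly in the others. *)
Lemma sum_private_le F j : F \subset triples n -> (#|F| <= n)%N -> (j <= n)%N ->
  (\sum_(X : {set {set 'I_n}} | #|X| == j)
      ((X \subset triples n) && private F X)%:R * p ^+ #|edges_of (F :|: X)|)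
    * j`!%:R <= p ^+ #|edges_of F| * extra_bound ^+ j.
Proof.
move=> Ft cF; elim: j => [|j IH] jn.
  rewrite (big_pred1 finset.set0) ?setU0 ?fact0 ?expr0 ?mulr1; last first.
    by move=> X; rewrite cards_eq0.
  by rewrite ler_piMl ?exprn_ge0 // lern1 leq_b1.
rewrite factS natrM mulrA [X in X * _]mulr_natr sum_card_succ.
apply: (@le_trans _ _ ((\sum_(X : {set {set 'I_n}} | #|X| == j)
   ((X \subset triples n) && private F X)%:R * p ^+ #|edges_of (F :|: X)|
      * extra_bound) * j`!%:R)); last first.
  rewrite -mulr_suml mulrAC exprSr mulrA ler_wpM2r ?extra_bound_ge0 //.
  by apply: IH; lia.
rewrite ler_wpM2r //; apply: ler_sum => Y /eqP cY.
have [/andP[Yt pY]|nY] := boolP (_ && _); last first.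
  rewrite !mul0r big1 // => t tY.
  case: (boolP (_ && _)) => [/andP[tYt /(privateU1 tY)[pY _]]|]; last by rewrite mul0r.
  by case/negP: nY; rewrite pY andbT; apply: subset_trans tYt; rewrite subsetUr.
rewrite mul1r.
have cH : (#|edges_of (F :|: Y)| <= 6 * n)%N.
  have FYt : F :|: Y \subset triples n by rewrite subUset Ft.
  apply: leq_trans (card_edges_of FYt) _.
  have := (leq_card_setU F Y).1; lia.
apply: le_trans (ler_wpM2l _ (sum_new_edges cH)); last exact: exprn_ge0.
rewrite mulr_sumr big_mkcond [leRHS]big_mkcond /=; apply: ler_sum => t _.
case: ifP => tY; last by case: ifP => // _; rewrite mulr_ge0 ?exprn_ge0.
case: (boolP (_ && private _ _)) => [/andP[tYt /(privateU1 tY)[_ /subsetPn[v vt vFY]]]|_]; last first.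
  by rewrite mul0r; case: ifP => // _; rewrite mulr_ge0 ?exprn_ge0.
have tt : t \in triples n by apply: (subsetP tYt); rewrite setU11.
rewrite tt (@new_edges_vertex n t (F :|: Y) v) //=; last first.
  by move: vFY; rewrite /cover bigcup_setU.
rewrite mul1r -exprD setUCA edges_ofU1 setUC cardsU cardsD setIC.
by rewrite addnBA // subset_leq_card ?subsetIl.
Qed.

End FirstMoments.

(** * Bounds on the law of the number of vertices in triangles *)

Section CoverBounds.
Import boot.fintype boot.finset.
Local Close Scope classical_set_scope.

Variables (R : realType) (n : nat).
Implicit Types (F X Y : {set {set 'I_n}}) (t : {set 'I_n}) (G : sgraph n).

Lemma triangles_sub_triples G : triangles G \subset triples n.
Proof. by apply/subsetP => t; rewrite in_triangles => /andP[]. Qed.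

(** [F] is a maximal packing of triangles of [G] and [X] a minimal family of
    triangles that covers the other vertices of triangles.  Every triangle meets
    [cover F] by maximality, so a member of [X] adds at most two vertices. *)
Lemma cover_packing_private G : exists F X,
  [/\ packing F, private F X, F :|: X \subset triangles G,
      (#|X| <= n)%N & (VT G <= 3 * #|F| + 2 * #|X|)%N].
Proof.
have P0 : packing (finset.set0 : {set {set 'I_n}}) && (finset.set0 \subset triangles G).
  rewrite /packing !finset.sub0set andbT /=; apply/trivIsetP => A B; by rewrite inE.
have [F /maxsetP[/andP[pF FG] maxF] _] :=
  maxset_exists (P := fun F => packing F && (F \subset triangles G)) P0.
have hit t : t \in triangles G -> ~~ (t \subset ~: cover F).
  move=> tG; apply/negP => tc.
  have tt : t \in triples n by apply: (subsetP (triangles_sub_triples G)).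
  have tF : t \notin F.
    apply/negP => tF; have /eqP c3 : #|t| == 3%N by move: tt; rewrite inE.
    have /card_gt0P[v vt] : (0 < #|t|)%N by rewrite c3.
    have := subsetP tc v vt; rewrite inE => /negP[]; by apply/bigcupP; exists t.
  have e : t |: F = F.
    by apply: maxF; rewrite ?subsetUr // packingU1 // pF tt tc subUset sub1set tG.
  by rewrite -e setU11 in tF.
pose U := cover (triangles G) :\: cover F.
(* Starting from one triangle per vertex to be covered keeps [X] of size at most
   [n]. *)
pose pickt (v : 'I_n) := odflt finset.set0 [pick t in triangles G | v \in t].
have picktP v : v \in U -> pickt v \in triangles G /\ v \in pickt v.
  rewrite inE => /andP[_ /bigcupP[t tG vt]]; rewrite /pickt.
  by case: pickP => [s /andP[]//|/(_ t)]; rewrite tG vt.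
pose P X := (X \subset triangles G) && (U \subset cover X).
have PU : P [set pickt v | v in U].
  apply/andP; split.
    by apply/subsetP => _ /imsetP[v /picktP[vG _] ->].
  apply/subsetP => v vU; apply/bigcupP; exists (pickt v); first exact: imset_f.
  by case: (picktP v vU).
have [X /minsetP[/andP[XG UX] minX] XU] := minset_exists PU.
exists F, X; split=> //.
- apply/forall_inP => t tX; apply/negP => tc.
  have tXX : X :\ t = X.
    apply: minX; last exact: subD1set.
    rewrite /P (subset_trans (subD1set X t) XG) /=.
    apply/subsetP => v vU; have /bigcupP[s sX vs] := subsetP UX v vU.
    have [est|nst] := eqVneq s t; last first.
      by apply/bigcupP; exists s => //; rewrite !inE nst.
    have := subsetP tc v; rewrite -est vs inE => /(_ isT) /orP[vF|//].
    by move: vU; rewrite inE vF.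
  by move: tX; rewrite -tXX setD11.
- by rewrite subUset FG XG.
- apply: leq_trans (subset_leq_card XU) _; apply: leq_trans (leq_imset_card _ _) _.
  by rewrite -[leqRHS](card_ord n) max_card.
rewrite VT_cover -(cardsID (cover F)) leq_add //.
  by rewrite -packing_card_cover // subset_leq_card // subsetIr.
rewrite -/U; apply: (@leq_trans #|\bigcup_(t in X) (t :\: cover F)|).
  apply/subset_leq_card/subsetP => v vU; have /bigcupP[s sX vs] := subsetP UX v vU.
  apply/bigcupP; exists s => //; rewrite inE vs andbT.
  by move: vU; rewrite inE => /andP[].
apply: leq_trans (card_bigcup_le _ _) _; rewrite mulnC -sum_nat_const.
apply: leq_sum => t /(subsetP XG) tG; rewrite -ltnS.
have /eqP <- : #|t| == 3%N.
  by have := subsetP (triangles_sub_triples G) t tG; rewrite inE.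
rewrite proper_card // properEneq subsetDl andbT; apply: contra (hit t tG) => /eqP <-.
by apply/subsetP => v; rewrite !inE => /andP[].
Qed.

Lemma packing_card_le F : packing F -> (3 * #|F| <= n)%N.
Proof. by move=> /packing_card_cover <-; rewrite -[leqRHS](card_ord n) max_card. Qed.

Variable p : R.
Hypothesis p01 : 0 < p <= 1.

Let p_gt0 : 0 < p. Proof. by case/andP: p01. Qed.
Let p_ge0 : 0 <= p. Proof. exact: ltW. Qed.

Definition npack (k : nat) : R := #|[set F : {set {set 'I_n}} | packing F & #|F| == k]|%:R.

(** Union bound over the families given by [cover_packing_private]. *)
Lemma VT_prob_le (q : nat) :
  Gnp_prob p (fun G : sgraph n => (q <= VT G)%N) <=
  \sum_(kj : 'I_n.+1 * 'I_n.+1 | (q <= 3 * kj.1 + 2 * kj.2)%N && (3 * kj.1 <= n)%N)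
     npack kj.1 * p ^+ (3 * kj.1) * (extra_bound n p ^+ kj.2 / kj.2`!%:R).
Proof.
pose ok (k j : nat) (FX : {set {set 'I_n}} * {set {set 'I_n}}) :=
  (packing FX.1 && (#|FX.1| == k)) &&
  ((#|FX.2| == j) && ((FX.2 \subset triples n) && private FX.1 FX.2)).
pose B (k j : nat) (G : sgraph n) :=
  [exists FX, ok k j FX && (edges_of (FX.1 :|: FX.2) \subset G)].
apply: (@le_trans _ _ (\sum_(kj : 'I_n.+1 * 'I_n.+1
     | (q <= 3 * kj.1 + 2 * kj.2)%N && (3 * kj.1 <= n)%N) Gnp_prob p (B kj.1 kj.2))).
  apply: Gnp_prob_union => // G qG.
  have [F [X [pF pX FXG Xn VTle]]] := cover_packing_private G.
  have cF := packing_card_le pF.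
  have Fn : (#|F| < n.+1)%N by lia.
  apply/existsP; exists (Ordinal Fn, Ordinal (Xn : #|X| < n.+1)%N) => /=.
  rewrite (leq_trans qG VTle) cF /=; apply/existsP; exists (F, X) => /=.
  rewrite /ok /= pF pX !eqxx /=; move: FXG.
  rewrite sub_triangles => /andP[FXt ->]; rewrite !andbT.
  by move: FXt; rewrite subUset => /andP[].
apply: ler_sum => -[k j] /= /andP[_ kn].
apply: (@le_trans _ _ (\sum_(FX | ok k j FX)
   Gnp_prob p (fun G : sgraph n => edges_of (FX.1 :|: FX.2) \subset G))).
  by apply: Gnp_prob_union => // G.
under eq_bigr do rewrite Gnp_prob_edges.
rewrite -(pair_big_dep (fun F => packing F && (#|F| == k))
   (fun F X => (#|X| == j) && ((X \subset triples n) && private F X))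
   (fun F X => p ^+ #|edges_of (F :|: X)|)) /=.
rewrite /npack -sum1_card natr_sum !mulr_suml.
rewrite [leRHS](eq_bigl (fun F => packing F && (#|F| == k :> nat))); last first.
  by move=> F; rewrite inE.
apply: ler_sum => F /andP[pF /eqP cF]; rewrite mul1r mulrA ler_pdivlMr ?ltr0n ?fact_gt0 //.
have := @sum_private_le R n p p01 F j (packing_sub pF).
rewrite card_edges_of_packing // cF => h; apply: le_trans (h _ _).
- rewrite ler_wpM2r //.
  rewrite [leRHS](eq_bigr (fun X => if (X \subset triples n) && private F X then
     p ^+ #|edges_of (F :|: X)| else 0)); last first.
    by move=> X _; case: ifP => _; rewrite ?mul1r ?mul0r.
  by rewrite -big_mkcondr.
- by rewrite -ltnS ltn_ord.
- by rewrite -ltnS ltn_ord.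
Qed.

(** Restricting to graphs with at most [k + s] triangles loses at most half of the
    first moment of the packings, by Markov's inequality for the number of
    triangles outside a given packing; such a graph contains at most
    [C(k + s, k)] packings of size [k]. *)
Lemma VT_prob_ge (k s : nat) : 2 * extra_bound n p <= s.+1%:R -> (3 * k <= n)%N ->
  npack k * p ^+ (3 * k) <=
  2 * ((k + s) ^ s)%:R * Gnp_prob p (fun G : sgraph n => (3 * k <= VT G)%N).
Proof.
move=> hs kn.
pose few (G : sgraph n) := (#|triangles G| <= k + s)%N.
have one F : packing F -> #|F| = k ->
    p ^+ (3 * k) <= 2 * Gnp_prob p (fun G => (F \subset triangles G) && few G).
  move=> pF cF.
  have cE : #|edges_of F| = (3 * k)%N by rewrite card_edges_of_packing // cF.
  have FT : F \subset triples n by exact: packing_sub.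
  have markov : s.+1%:R * Gnp_prob p (fun G => (F \subset triangles G) && ~~ few G)
      <= p ^+ (3 * k) * extra_bound n p.
    apply: (@le_trans _ _ (\sum_(t in triples n | t \notin F)
        Gnp_prob p (fun G => edges_of (t |: F) \subset G))).
      rewrite Gnp_probE mulr_sumr.
      under [leRHS]eq_bigr do rewrite Gnp_probE.
      rewrite exchange_big /=; apply: ler_sum => G _.
      rewrite -mulr_sumr mulrCA ler_wpM2l ?Gnp_weight_ge0 //.
      case: (boolP (_ && _)) => [/andP[FG]|_]; last by rewrite mulr0 sumr_ge0.
      rewrite /few -ltnNge => big; rewrite mulr1 -natr_sum ler_nat.
      apply: (@leq_trans #|triangles G :\: F|).
        by rewrite cardsD (setIidPr FG) cF; lia.
      rewrite -sum1_card big_mkcond [leqRHS]big_mkcond /=; apply: leq_sum => t _.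
      rewrite inE in_triangles; case: ifP => // /and3P[tF -> tG].
      rewrite tF /= edges_ofU1 subUset tG /=.
      by move: FG; rewrite sub_triangles => /andP[_ ->].
    apply: le_trans (ler_wpM2l _ (@sum_new_edges R n p p01 (edges_of F) _)).
    - rewrite mulr_sumr; under eq_bigr do rewrite Gnp_prob_edges.
      rewrite big_mkcondr [leRHS]big_mkcondr /=; apply: ler_sum => t tt.
      case: ifP => [tF|_]; last by case: ifP => // _; rewrite mulr_ge0 ?exprn_ge0.
      rewrite new_edges_packing // -exprD -cE edges_ofU1 setUC cardsU cardsD setIC.
      by rewrite addnBA // subset_leq_card ?subsetIl.
    - exact: exprn_ge0.
    - rewrite cE; lia.
  have tot : p ^+ (3 * k) = Gnp_prob p (fun G => (F \subset triangles G) && few G)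
      + Gnp_prob p (fun G => (F \subset triangles G) && ~~ few G).
    rewrite -cE -Gnp_prob_edges !Gnp_probE -big_split /=; apply: eq_bigr => G _.
    by rewrite sub_triangles FT -mulrDr; case: (few G); case: (_ \subset G);
      rewrite ?addr0 ?add0r.
  have s0 : 0 < s.+1%:R :> R by rewrite ltr0n.
  have : s.+1%:R * Gnp_prob p (fun G => (F \subset triangles G) && ~~ few G)
      <= s.+1%:R * (p ^+ (3 * k) / 2).
    apply: le_trans markov _.
    by rewrite mulrCA ler_wpM2l ?exprn_ge0 // ler_pdivlMr // mulrC.
  rewrite ler_pM2l //; lra.
rewrite /npack -sum1_card natr_sum mulr_suml.
apply: (@le_trans _ _ (\sum_(F in [set F | packing F & #|F| == k])
   2 * Gnp_prob p (fun G => (F \subset triangles G) && few G))).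
  by apply: ler_sum => F; rewrite inE mul1r => /andP[pF /eqP cF]; apply: one.
rewrite -mulr_sumr -mulrA ler_wpM2l //.
under eq_bigr do rewrite Gnp_probE.
rewrite exchange_big /= Gnp_probE mulr_sumr; apply: ler_sum => G _.
rewrite -mulr_sumr mulrCA ler_wpM2l ?Gnp_weight_ge0 //.
rewrite -natr_sum -natrM ler_nat.
case: (boolP (few G)) => [fG|_]; last by rewrite big1 // => F _; rewrite andbF.
have [big|small] := leqP (3 * k) (VT G); last first.
  rewrite big1 // => F; rewrite inE => /andP[pF /eqP cF]; rewrite andbT.
  case: (boolP (F \subset _)) => // FG; move: small; rewrite ltnNge VT_cover.
  rewrite -cF -packing_card_cover // subset_leq_card //.
  by apply/bigcupsP => t tF; apply: bigcup_sup (subsetP FG t tF).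
rewrite muln1; apply: (@leq_trans 'C(k + s, s)).
  apply: (@leq_trans 'C(#|triangles G|, k)).
    rewrite -cards_draws -sum1_card big_mkcond [leqRHS]big_mkcond /=.
    apply: leq_sum => F _; rewrite !inE andbT.
    by case: (packing F); case: (#|F| == k); case: (F \subset _).
  rewrite -(bin_sub (leq_addl k s)) addnK; exact: leq_bin2l.
exact: bin_leq_exp.
Qed.

Lemma Gnp_prob_add_edges (A : pred (sgraph n)) (E : {set edge n}) :
  p ^+ #|E| * Gnp_prob p (fun G => A (E :|: G)) <= Gnp_prob p A.
Proof.
move: {2}#|E| (erefl #|E|) => k; elim: k E A => [|k IH] E A cE.
  rewrite cE (cards0_eq cE) expr0 mul1r; apply: Gnp_prob_le => // G.
  by rewrite unfold_in set0U.
have /card_gt0P[e eE] : (0 < #|E|)%N by rewrite cE.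
have := cardsD1 e E; rewrite eE cE => -[/esym]; rewrite add0n => cE'.
apply: le_trans (Gnp_prob_add_edge p01 A e); rewrite exprS -mulrA ler_wpM2l //.
apply: le_trans (IH (E :\ e) (fun G => A (e |: G)) cE').
rewrite cE' ler_wpM2l ?exprn_ge0 //; apply: Gnp_prob_le => // G.
by rewrite !unfold_in setUA setD1K.
Qed.

(** If exactly [m < n] vertices lie in triangles, then adding the edges of one of
    the at most [n ^ 3] triples, chosen at an uncovered vertex, increases this
    number; each triple costs a factor [p ^ - 3]. *)
Lemma VT_prob_succ (m : nat) : (3 <= n)%N -> (m < n)%N ->
  Gnp_prob p (fun G : sgraph n => (m <= VT G)%N) <=
  (1 + n%:R ^+ 3 / p ^+ 3) * Gnp_prob p (fun G : sgraph n => (m < VT G)%N).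
Proof.
move=> n3 mn.
pose A (G : sgraph n) := (m < VT G)%N.
have addP t : t \in triples n -> Gnp_prob p (fun G => A (edges_in t :|: G))
    <= Gnp_prob p A / p ^+ 3.
  move=> tt; rewrite ler_pdivlMr ?exprn_gt0 // mulrC.
  by have := Gnp_prob_add_edges A (edges_in t); rewrite card_edges_in3.
apply: (@le_trans _ _ (Gnp_prob p A + \sum_(t in triples n)
    Gnp_prob p (fun G => A (edges_in t :|: G)))).
  rewrite !Gnp_probE; under [X in _ <= _ + X]eq_bigr do rewrite Gnp_probE.
  rewrite exchange_big -big_split /=; apply: ler_sum => G _.
  rewrite -mulr_sumr -mulrDr ler_wpM2l ?Gnp_weight_ge0 // -natr_sum -natrD ler_nat.
  case: (leqP m (VT G)) => // mV; rewrite lt0n addn_eq0 eqb0 -leqNgt.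
  apply/negP => /andP[Vm /eqP s0].
  have eV : #|cover (triangles G)| = m by rewrite -VT_cover; apply/eqP; rewrite eqn_leq Vm.
  have /subsetPn[v _ vV] : ~~ ([set: 'I_n] \subset cover (triangles G)).
    apply/negP => /subset_leq_card; rewrite cardsT card_ord eV; lia.
  have [t tt vt] := exists_triple v n3.
  suff h : A (edges_in t :|: G) by move: s0; rewrite (bigD1 t) //= h.
  rewrite /A VT_cover -eV; apply/proper_card/properP; split.
    apply/subsetP => w /bigcupP[s]; rewrite in_triangles => /andP[st sG] ws.
    by apply/bigcupP; exists s; rewrite // in_triangles st (subset_trans sG) ?subsetUr.
  by exists v => //; apply/bigcupP; exists t => //; rewrite in_triangles tt subsetUl.
rewrite mulrDl mul1r lerD2l.
apply: (@le_trans _ _ (\sum_(t in triples n) Gnp_prob p A / p ^+ 3)).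
  by apply: ler_sum => t /addP.
rewrite sumr_const -[leLHS]mulr_natl [leRHS]mulrAC -[leRHS]mulrA.
rewrite ler_wpM2r ?divr_ge0 ?exprn_ge0 ?Gnp_prob_ge0 //.
by rewrite -natrX ler_nat card_triples bin_leq_exp.
Qed.

End CoverBounds.

(** * The function x ln x - x, factorials and Gamma *)

Section Entropy.
Variable R : realType.
Implicit Types x y z : R.

(** [expR (ent x)] is the main term of Stirling's approximation to [x!].  Since
    [ln 0] is 0, it also has the right value at [x = 0]. *)
Definition ent x : R := x * ln x - x.

Lemma ent0 : ent 0 = 0.
Proof. by rewrite /ent mul0r subr0. Qed.

Lemma ent1 : ent 1 = -1.
Proof. by rewrite /ent ln1 mulr0 sub0r. Qed.

Lemma ln_tangent x y : 0 < x -> 0 < y -> ln x <= ln y + (x - y) / y.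
Proof.
move=> x0 y0.
have xy0 : 0 < x / y by rewrite divr_gt0.
have : ln (x / y) <= x / y - 1.
  have -> : ln (x / y) = ln (1 + (x / y - 1)) by congr ln; ring.
  by apply: le_ln1Dx; rewrite ltrBrDr addrC subrr.
rewrite ln_div ?posrE // => h.
have -> : (x - y) / y = x / y - 1 by field; rewrite gt_eqF.
lra.
Qed.

(** [ent] is convex with derivative [ln]. *)
Lemma ent_tangent x y : 0 < x -> 0 <= y -> (y - x) * ln x <= ent y - ent x.
Proof.
move=> x0; rewrite le_eqVlt => /predU1P[<-|y0]; first by rewrite ent0 /ent; lra.
have := ln_tangent x0 y0; rewrite -(ler_pM2l y0).
have -> : y * (ln y + (x - y) / y) = y * ln y + (x - y) by field; rewrite gt_eqF.
rewrite /ent; lra.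
Qed.

Lemma ent_ge x : 0 <= x -> -1 <= ent x.
Proof.
by move=> x0; have := @ent_tangent 1 x ltr01 x0; rewrite ent1 ln1 mulr0; lra.
Qed.

(** [expR] is the Legendre transform of [ent]. *)
Lemma le_expR_ent c x : 0 <= x -> c * x - ent x <= expR c.
Proof.
move=> x0; have := ent_tangent (expR_gt0 c) x0; rewrite {2}/ent expRK; lra.
Qed.

Lemma ent_superadd x y : 0 <= x -> 0 <= y -> ent x + ent y <= ent (x + y).
Proof.
have key (u v : R) : 0 <= u -> 0 <= v -> u * ln u <= u * ln (u + v).
  rewrite le_eqVlt => /predU1P[<-|u0] v0; first by rewrite !mul0r.
  by rewrite ler_pM2l // ler_ln ?posrE ?ltr_wpDr // lerDl.
move=> x0 y0; have := key _ _ x0 y0; have := key _ _ y0 x0.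
rewrite /ent (addrC y x); lra.
Qed.

Lemma ln_fact_ge (m : nat) : ent m%:R <= ln (m`!%:R : R).
Proof.
elim: m => [|m IH]; first by rewrite ent0 fact0 ln1.
have m0 : 0 < m.+1%:R :> R by rewrite ltr0n.
rewrite factS natrM lnM ?posrE ?ltr0n ?fact_gt0 //.
have := ent_tangent m0 (ler0n R m); rewrite -(natr1 m); lra.
Qed.

Lemma ln_fact_le (m : nat) : ln (m`!%:R : R) <= ent m%:R + 1 + ln m%:R.
Proof.
elim: m => [|[|m] IH].
- by rewrite ent0 fact0 ln1 ln0 //; lra.
- by rewrite ent1 ln1; lra.
have m0 : 0 < m.+1%:R :> R by rewrite ltr0n.
rewrite factS natrM lnM ?posrE ?ltr0n ?fact_gt0 //.
have := ent_tangent m0 (ler0n R m.+2); rewrite -(natr1 m.+1) in IH *; lra.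
Qed.

Let gammaf x (t : R) := t `^ x * expR (- t).

Let measurable_gammaf x (D : set R) : measurable_fun D (fun t : R => (gammaf x t)%:E).
Proof.
apply: measurable_funTS; apply/measurable_EFinP; apply: measurable_funM.
  exact: measurable_powR.
by apply: measurableT_comp => //; exact: measurableT_comp.
Qed.

Let gammaf_ge0 x t : (0 <= (gammaf x t)%:E)%E.
Proof. by rewrite lee_fin mulr_ge0 ?powR_ge0 ?expR_ge0. Qed.

(** The factor [expR (- t)] is split as [expR (- (1 - d) * t) * expR (- d * t)]
    with [d = (x + 1)^-1].  The maximum of [t `^ x * expR (- (1 - d) * t)] exceeds
    that of [t `^ x * expR (- t)] by a factor at most [e], and what remains is
    [x + 1] times the density of an exponential law of parameter [d]. *)
Let gamma_le x : 0 < x ->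
  (\int[lebesgue_measure]_(t in `]0%R, +oo[) (gammaf x t)%:E <=
    ((x + 1) * expR (ent x + 1))%:E)%E.
Proof.
move=> x0; have [d dE] : exists d : R, d = (x + 1)^-1 by exists (x + 1)^-1.
have x1 : 0 < x + 1 by lra.
have d0 : 0 < d by rewrite dE invr_gt0.
have dx : d * (x + 1) = 1 by rewrite dE mulVf ?gt_eqF.
set c := (x + 1) * _.
have c0 : 0 <= c by rewrite mulr_ge0 ?expR_ge0 // ltW.
have mpdf : measurable_fun [set: R] (fun t : R => (exponential_pdf d t)%:E).
  by apply/measurable_EFinP; exact: measurable_exponential_pdf.
have pdf0 (t : R) : (0 <= (exponential_pdf d t)%:E)%E.
  by rewrite lee_fin exponential_pdf_ge0 // ltW.
apply: (@le_trans _ _ (\int[lebesgue_measure]_t (c%:E * (exponential_pdf d t)%:E))%E); last first.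
  rewrite ge0_integralZl_EFin //.
  by rewrite integral_exponential_pdf // mule1.
apply: (@le_trans _ _ (\int[lebesgue_measure]_(t in `]0%R, +oo[) (c%:E * (exponential_pdf d t)%:E))%E).
  apply: ge0_le_integral => //.
  - exact: measurable_gammaf.
  - apply: measurable_funTS; exact: measurable_funeM.
  move=> t; rewrite /= in_itv/= andbT => t0.
  rewrite -EFinM lee_fin exponential_pdfE ?(ltW t0) // /c /gammaf.
  have -> : (x + 1) * expR (ent x + 1) * (d * expR (- d * t)) =
      expR (ent x + 1 - d * t).
    by rewrite [RHS]expRD mulNr mulrACA [_ * d]mulrC dx mul1r.
  rewrite /powR (gt_eqF t0) -expRD ler_expR.
  have h1 := ln_tangent t0 x1.
  have h2 := ln_tangent x1 x0.
  have : x * ln t <= x * ln x + 1 + x * ((t - (x + 1)) * d).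
    rewrite (_ : _ + 1 + _ = x * (ln x + ((x + 1) - x) / x + (t - (x + 1)) * d)); last first.
      by field; rewrite gt_eqF.
    rewrite ler_pM2l //; move: h1; rewrite -dE; lra.
  have -> : x * ((t - (x + 1)) * d) = t * (d * (x + 1)) - t * d - x * (d * (x + 1)) by ring.
  rewrite dx.
  by rewrite /ent; lra.
apply: ge0_subset_integral => //.
- exact: measurable_funeM.
- by move=> t _; rewrite mule_ge0.
Qed.

(** The integrand is at least [x `^ x * expR (- (x + 1))] on [[x, x + 1]]. *)
Let gamma_ge x : 0 < x ->
  ((expR (ent x - 1))%:E <=
   \int[lebesgue_measure]_(t in `]0%R, +oo[) (gammaf x t)%:E)%E.
Proof.
move=> x0.
apply: (@le_trans _ _ (\int[lebesgue_measure]_(t in `[x, (x + 1)%R]) (gammaf x t)%:E)%E); last first.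
  apply: ge0_subset_integral => //; first exact: measurable_gammaf.
  by move=> t; rewrite /= !in_itv/= andbT => /andP[xt _]; exact: lt_le_trans xt.
apply: (@le_trans _ _ (\int[lebesgue_measure]_(t in `[x, (x + 1)%R]) (cst (expR (ent x - 1))%:E t))%E).
  rewrite integral_cst //= lebesgue_measure_itv /= lte_fin ltrDl ltr01.
  by rewrite -EFinB (_ : x + 1 - x = 1) ?mule1 //; ring.
apply: ge0_le_integral => //; first by move=> t _; rewrite lee_fin expR_ge0.
  exact: measurable_gammaf.
move=> t; rewrite /= in_itv/= => /andP[xt tx].
have t0 : 0 < t by exact: lt_le_trans xt.
rewrite lee_fin /gammaf /powR (gt_eqF t0) -expRD ler_expR /ent.
have : x * ln x <= x * ln t by rewrite ler_pM2l // ler_ln ?posrE.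
lra.
Qed.

Lemma rfact_bounds x : 0 < x ->
  expR (ent x - 1) <= rfact x <= (x + 1) * expR (ent x + 1).
Proof.
move=> x0; rewrite /rfact /Gamma addrK /Rintegral -/(gammaf x).
have hu := gamma_le x0; have hl := gamma_ge x0.
have fin : (\int[lebesgue_measure]_(t in `]0%R, +oo[) (gammaf x t)%:E)%E \is a fin_num.
  rewrite ge0_fin_numE; last by apply: integral_ge0.
  exact: le_lt_trans hu (ltry _).
by rewrite -!lee_fin fineK // hl hu.
Qed.

End Entropy.

(** * The exponential rate and its variations *)

Section Rate.
Variable R : realType.
Implicit Types x y z q d u a N lam : R.

(** The logarithm of
    [N ^_ x / (6 `^ (x / 3) * (x / 3)!) * (lam / N) ^ x], with each factorial
    [y!] replaced by [expR (ent y)]. *)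
Definition rate N lam x : R :=
  ent N - ent (N - x) - x / 3 * ln 6 - ent (x / 3) + x * ln (lam / N).

(** The part of the derivative of [rate] that does not depend on [N] or [x]. *)
Definition slope lam : R := ln lam - ln 6 / 3.

Lemma rate_incr_le N lam x y : 1 <= N -> 0 < lam -> 0 <= x <= y -> y <= N ->
  rate N lam y - rate N lam x <= (y - x) * slope lam - (ent (y / 3) - ent (x / 3)).
Proof.
move=> N1 lam0 /andP[x0 xy] yN; have N0 : 0 < N by lra.
have : ent (N - x) - ent (N - y) <= (y - x) * ln N.
  have [xN|xN] := ltP x N; last first.
    have -> : y = x by lra.
    by lra.
  have Nx : 0 < N - x by lra.
  have Ny : 0 <= N - y by lra.
  have := ent_tangent Nx Ny.
  have : (y - x) * ln (N - x) <= (y - x) * ln N.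
    by rewrite ler_wpM2l ?subr_ge0 // ler_ln ?posrE //; lra.
  lra.
by rewrite /rate /slope ln_div ?posrE //; lra.
Qed.

(** Beyond [u] the rate decreases, since the tangent slope of [ent] exceeds that
    of the linear part.  From a point [x] below [u], the increase up to any [y] is
    at most a constant, by the Legendre bound [le_expR_ent] at [y / 3], plus the
    terms in [x], of order [u * ln N]. *)
Lemma rate_mono N lam u x y : 1 <= N -> 0 < lam -> 0 <= x <= y -> y <= N ->
  0 < u -> 3 * slope lam <= ln (u / 3) ->
  rate N lam y <= rate N lam x + expR (3 * slope lam) + u * (ln N + `|slope lam|).
Proof.
move=> N1 lam0 xy yN u0 hu; have := rate_incr_le N1 lam0 xy yN.
have /andP[x0 xy'] := xy.
set c := slope lam in hu *; have cabs : - c <= `|c| by rewrite ler_normr lexx orbT.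
have lN : 0 <= ln N by apply: ln_ge0.
have e0 : 0 < expR (3 * c) by exact: expR_gt0.
have [ux|xu] := ltP u x.
  have x3 : 0 < x / 3 by lra.
  have y3 : 0 <= y / 3 by lra.
  have := ent_tangent x3 y3.
  have : (y - x) * c <= (y - x) * (ln (x / 3) / 3).
    rewrite ler_wpM2l ?subr_ge0 //.
    have : ln (u / 3) <= ln (x / 3) by rewrite ler_ln ?posrE; lra.
    lra.
  have : 0 <= u * (ln N + `|c|) by rewrite mulr_ge0 ?addr_ge0 // ltW.
  lra.
have y3 : 0 <= y / 3 by lra.
have := le_expR_ent (3 * c) y3.
have h1 : ent (x / 3) <= u * ln N.
  move: x0; rewrite le_eqVlt => /predU1P[<-|x0]; first by rewrite mul0r ent0 mulr_ge0 // ltW.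
  have : x / 3 * ln (x / 3) <= x / 3 * ln N.
    by rewrite ler_pM2l ?divr_gt0 // ler_ln ?posrE; lra.
  have : x / 3 * ln N <= u * ln N by rewrite ler_wpM2r //; lra.
  rewrite /ent; lra.
have h2 : - c * x <= `|c| * u.
  apply: (@le_trans _ _ (`|c| * x)); first by rewrite ler_wpM2r.
  by rewrite ler_wpM2l.
lra.
Qed.

(** Superadditivity of [ent] handles [(N - x)!], where the tangent bound would be
    useless: [q] may be as large as [N]. *)
Lemma rate_decr_le N lam x q : 1 <= N -> 0 < lam -> 0 <= x <= q -> q <= N ->
  rate N lam x - rate N lam q <=
    - ent (q - x) + (q - x) * (4 / 3 * ln N - slope lam).
Proof.
move=> N1 lam0 /andP[x0 xq] qN; have N0 : 0 < N by lra.
have h1 : ent (N - q) + ent (q - x) <= ent (N - x).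
  have -> : N - x = (N - q) + (q - x) by ring.
  by apply: ent_superadd; lra.
have h2 : ent (q / 3) - ent (x / 3) <= (q - x) / 3 * ln N.
  move: (le_trans x0 xq); rewrite le_eqVlt => /predU1P[q0|q0].
    have -> : x = q by lra.
    by lra.
  have q3 : 0 < q / 3 by lra.
  have x3 : 0 <= x / 3 by lra.
  have := ent_tangent q3 x3.
  have : (q - x) / 3 * ln (q / 3) <= (q - x) / 3 * ln N.
    by rewrite ler_wpM2l ?divr_ge0 ?subr_ge0 // ler_ln ?posrE; lra.
  lra.
by rewrite /rate /slope ln_div ?posrE //; lra.
Qed.

Lemma rate_drop_small N lam u x q : 1 <= N -> 0 < lam -> 0 <= x <= q -> q <= N ->
  q - x <= u -> rate N lam x <= rate N lam q + 1 + u * (4 / 3 * ln N + `|slope lam|).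
Proof.
move=> N1 lam0 xq qN du; have := rate_decr_le N1 lam0 xq qN.
have /andP[x0 xq'] := xq; have d0 : 0 <= q - x by lra.
have := ent_ge d0.
set c := slope lam; have cabs : - c <= `|c| by rewrite ler_normr lexx orbT.
have lN : 0 <= ln N by apply: ln_ge0.
have : (q - x) * (4 / 3 * ln N - c) <= u * (4 / 3 * ln N + `|c|).
  apply: (@le_trans _ _ ((q - x) * (4 / 3 * ln N + `|c|))).
    by rewrite ler_wpM2l //; lra.
  by rewrite ler_wpM2r //; have := normr_ge0 c; lra.
lra.
Qed.

(** The gain [4/3 * d * ln N - ent d] from leaving [d = q - x] vertices out of the
    packing is beaten by [ent z >= ent (d / 2)], roughly [d / 2 * ln d], as soon as
    [3/2 * ln d] exceeds [4/3 * ln N] by a constant. *)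
Lemma rate_drop_large N lam u a x q z : 1 <= N -> 0 < lam -> 0 <= x <= q -> q <= N ->
  0 < u -> u <= q - x -> q - x <= 2 * z ->
  a <= ln (u / 2) ->
  4 / 3 * ln N + (3 / 2 - slope lam + a / 2 + ln 2 / 2) <= 3 / 2 * ln u ->
  rate N lam x + (a * z - ent z) <= rate N lam q.
Proof.
move=> N1 lam0 xq qN u0 ud dz ha hu; have := rate_decr_le N1 lam0 xq qN.
set d := q - x in ud dz *.
have d0 : 0 < d by lra.
have d2 : 0 < d / 2 by lra.
have z0 : 0 <= z by lra.
have lud : ln u <= ln d by rewrite ler_ln ?posrE.
have lu2 : ln (u / 2) <= ln (d / 2) by rewrite ler_ln ?posrE; lra.
have := ent_tangent d2 z0.
have : (z - d / 2) * a <= (z - d / 2) * ln (d / 2).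
  by rewrite ler_wpM2l; lra.
rewrite /(ent (d / 2)) /(ent d) ln_div ?posrE //.
have : d * (4 / 3 * ln N + (3 / 2 - slope lam + a / 2 + ln 2 / 2)) <= d * (3 / 2 * ln d).
  by rewrite ler_pM2l //; lra.
lra.
Qed.

(** The exponent can be any number in the interval from 8/9, excluded, to 19/20,
    excluded: above 8/9 for [rate_drop_large], below 19/20 for [err_littleo]. *)
Definition err N : R := N `^ (9 / 10) * ln N.

Lemma err_bounds N : 1 <= ln N -> [/\ 1 <= N, 1 <= N `^ (9 / 10), ln N <= err N & 1 <= err N].
Proof.
move=> lN.
have N0 : 0 < N by rewrite ltNge; apply/negP => /ln0 h; move: lN; rewrite h; lra.
have N1 : 1 <= N by rewrite -ler_ln ?posrE // ln1; lra.
have u1 : 1 <= N `^ (9 / 10).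
  by rewrite -ler_ln ?posrE ?powR_gt0 // ln1 ln_powR; lra.
have h : ln N <= err N by rewrite /err ler_peMl //; lra.
by split => //; lra.
Qed.

(** The estimates above at the threshold [u = N `^ (9 / 10)]. In the last one, [x]
    vertices are covered by a packing and [z] triangles cover the others. *)
Lemma rate_bounds lam a : 0 < lam -> exists K L0 : R, 1 <= L0 /\
  forall N, L0 <= ln N ->
  [/\ (forall x y, 0 <= x <= y -> y <= N -> rate N lam y <= rate N lam x + K * err N),
      (forall x y, 0 <= x <= y -> y <= N -> y - x <= 1 ->
         rate N lam x <= rate N lam y + K * err N)
    & (forall x q z, 0 <= x <= N -> 0 <= q <= N -> 0 <= z -> q <= x + 2 * z ->
         rate N lam x + (a * z - ent z) <= rate N lam q + K * err N)].
Proof.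
move=> lam0; set c := slope lam.
pose B := 3 / 2 - c + a / 2 + ln 2 / 2.
pose K := 3 + expR a + expR (3 * c) + `|c|.
(* [A1] and [A2] make [ln N] large enough for the last two hypotheses of
   [rate_drop_large], [A2] being for the bound on [a]; [A3] is for the last
   hypothesis of [rate_mono]. *)
have bnd x : exists y : R, 0 <= y /\ x <= y.
  by exists `|x|; split; [exact: normr_ge0 | exact: ler_norm].
have [A1 [A1_ge0 hA1]] := bnd (60 * B).
have [A2 [A2_ge0 hA2]] := bnd (2 * (a + ln 2)).
have [A3 [A3_ge0 hA3]] := bnd (2 * (3 * c + ln 3)).
exists K, (1 + A1 + A2 + A3); split; first by lra.
move=> N hN.
have lN : 1 <= ln N by lra.
have [N1 u1 LE E1] := err_bounds lN.
have N0 : 0 < N by lra.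
have lu := ln_powR N (9 / 10).
have u0 : 0 < N `^ (9 / 10) by lra.
have c0 := normr_ge0 c; have ea := expR_gt0 a; have ec := expR_gt0 (3 * c).
have hu3 : 3 * c <= ln (N `^ (9 / 10) / 3). by rewrite ln_div ?posrE // lu; lra.
have hu2 : a <= ln (N `^ (9 / 10) / 2) by rewrite ln_div ?posrE // lu; lra.
have hB : 4 / 3 * ln N + (3 / 2 - c + a / 2 + ln 2 / 2) <= 3 / 2 * ln (N `^ (9 / 10)).
  by rewrite lu -/B; lra.
have uc : N `^ (9 / 10) * `|c| <= `|c| * err N.
  by rewrite mulrC ler_wpM2l // /err ler_peMr // ltW.
have eaE : expR a <= expR a * err N by rewrite ler_peMr // ltW.
have ecE : expR (3 * c) <= expR (3 * c) * err N by rewrite ler_peMr // ltW.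
have mono x y : 0 <= x <= y -> y <= N ->
    rate N lam y <= rate N lam x + (expR (3 * c) * err N + err N + `|c| * err N).
  move=> xy yN; have := rate_mono N1 lam0 xy yN u0 hu3.
  have -> : N `^ (9 / 10) * (ln N + `|c|) = err N + N `^ (9 / 10) * `|c|.
    by rewrite mulrDr.
  lra.
have small x y : 0 <= x <= y -> y <= N -> y - x <= N `^ (9 / 10) ->
    rate N lam x <= rate N lam y + (err N + 4 / 3 * err N + `|c| * err N).
  move=> xy yN yx; have := rate_drop_small N1 lam0 xy yN yx.
  have -> : N `^ (9 / 10) * (4 / 3 * ln N + `|c|) = 4 / 3 * err N + N `^ (9 / 10) * `|c|.
    by rewrite /err; ring.
  lra.
have a1 := mulr_ge0 (ltW ea) (le_trans ler01 E1).
have a2 := mulr_ge0 (ltW ec) (le_trans ler01 E1).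
have KE : K * err N = 3 * err N + expR a * err N + expR (3 * c) * err N + `|c| * err N.
  by rewrite /K; ring.
split=> [x y xy yN|x y xy yN yx|x q z /andP[x0 xN] /andP[q0 qN] z0 qxz].
- have := mono x y xy yN; lra.
- have := small x y xy yN (le_trans yx u1); lra.
have hz := le_expR_ent a z0.
have [xq|qx] := leP x q; last first.
  have qx' : 0 <= q <= x by rewrite q0 ltW.
  have := mono q x qx' xN; lra.
have xq' : 0 <= x <= q by rewrite x0.
have [du|ud] := leP (q - x) (N `^ (9 / 10)).
  have := small x q xq' qN du; lra.
have dz : q - x <= 2 * z by lra.
have := rate_drop_large N1 lam0 xq' qN u0 (ltW ud) dz hu2 hB.
have := mulr_ge0 c0 (le_trans ler01 E1); lra.
Qed.

(** With [L = ln n], the quotient of the two sides is [L * expR (- L / 20)], and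
    [expR (L / 20)] is at least [L ^+ 2 / 800]. *)
Lemma err_littleo (f : nat -> R) (K : R) (n0 : nat) :
  (forall n, (n0 <= n)%N -> `|f n| <= K * err n%:R) ->
  f =o_\oo (fun n : nat => n%:R `^ (19 / 20) : R).
Proof.
move=> hf; apply/eqoP => e e0 /=.
pose L := 1 + `|800 * K / e|.
near=> n.
have nL : expR L <= n%:R by near: n; exact: nbhs_infty_ger.
have nn : (n0 <= n)%N by near: n; exact: nbhs_infty_ge.
have n_gt0 : 0 < n%:R :> R by apply: lt_le_trans nL; exact: expR_gt0.
have lL : L <= ln n%:R by rewrite -ler_expR lnK.
have KL : 800 * K / e <= ln n%:R.
  have := ler_norm (800 * K / e); move: lL; rewrite /L; lra.
have L0 : 0 <= ln (n%:R : R) by have := normr_ge0 (800 * K / e); move: lL; rewrite /L; lra.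
apply: le_trans (hf n nn) _; rewrite ger0_norm ?powR_ge0 //.
have -> : n%:R `^ (19 / 20) = n%:R `^ (9 / 10) * expR (ln n%:R / 20) :> R.
  rewrite (_ : 19 / 20 = 9 / 10 + 1 / 20); last by field.
  rewrite powRD ?gt_eqF ?implybT // {2}/powR gt_eqF //; congr (_ * expR _).
  by rewrite mulrC mulrA mulr1.
rewrite /err !mulrA [K * _]mulrC [e * _]mulrC -!mulrA ler_wpM2l ?powR_ge0 //.
have L20 : 0 <= ln (n%:R : R) / 20 by rewrite divr_ge0.
have := expR_ge1Dxn 1 L20; rewrite -(ler_pM2l e0) => h; apply: le_trans h.
have h : e * (800 * K / e * ln n%:R) <= e * (ln n%:R * ln n%:R).
  by rewrite ler_pM2l // ler_wpM2r.
have hE : e * (800 * K / e * ln n%:R) = 800 * (K * ln n%:R) by field; rewrite gt_eqF.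
rewrite hE in h.
rewrite (_ : 2`! = 2)%N //; lra.
Unshelve. all: by end_near. Qed.

End Rate.

(** * Asymptotics *)

Section Estimates.
Variables (R : realType) (lam : R).
Hypothesis lam0 : 0 < lam.

Lemma ln_natr_le (m n : nat) : (m <= n)%N -> ln (m%:R : R) <= ln (n%:R : R).
Proof.
case: m => [|m] mn; last by rewrite ler_ln ?posrE ?ltr0n ?ler_nat //; lia.
rewrite [X in X <= _]ln0 //; case: n mn => [|n] _; first by rewrite ln0.
by rewrite ln_ge0 // ler1n.
Qed.

Lemma ln_ffact (n m : nat) : (m <= n)%N ->
  ln ((n ^_ m)%:R : R) = ln (n`!%:R : R) - ln ((n - m)`!%:R : R).
Proof.
move=> mn; rewrite -(ffact_fact mn) natrM lnM ?posrE ?ltr0n ?fact_gt0 ?ffact_gt0 //.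
by rewrite addrK.
Qed.

Lemma ln_succ_le (x n : R) : 1 <= n -> 0 <= x <= n -> ln (x + 1) <= ln n + 2.
Proof.
move=> n1 /andP[x0 xn]; apply: (@le_trans _ _ (ln (n * 2))).
  by rewrite ler_ln ?posrE; lra.
have n0 : 0 < n by lra.
have := @ln_sublinear R 2; rewrite lnM ?posrE //; lra.
Qed.

Lemma npack_bounds (n k : nat) : (0 < n)%N -> (3 * k <= n)%N ->
  expR (rate n%:R lam (3 * k)%:R - 2 - 2 * ln n%:R) <=
    npack R n k * (lam / n%:R) ^+ (3 * k) <=
  expR (rate n%:R lam (3 * k)%:R + 1 + ln n%:R).
Proof.
move=> n0 kn.
have n0' : 0 < n%:R :> R by rewrite ltr0n.
have p0 : 0 < lam / n%:R by rewrite divr_gt0.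
have cardE := card_packings n k.
have card0 : (0 < #|[set F : {set {set 'I_n}} | packing F & (#|F| == k)%N]%SET|)%N.
  by case: #|_| cardE => // /esym/eqP; rewrite mul0n eqn0Ngt ffact_gt0 kn.
have N0 : 0 < npack R n k by rewrite /npack ltr0n.
have X0 : 0 < npack R n k * (lam / n%:R) ^+ (3 * k) by rewrite mulr_gt0 ?exprn_gt0.
have lnN : ln (npack R n k) =
    ln (n`!%:R : R) - ln ((n - 3 * k)`!%:R : R) - k%:R * ln 6 - ln (k`!%:R : R).
  rewrite -ln_ffact // -cardE natrM /npack natrM natrX.
  rewrite lnM ?posrE ?mulr_gt0 ?exprn_gt0 ?ltr0n ?fact_gt0 //.
  rewrite lnM ?posrE ?exprn_gt0 ?ltr0n ?fact_gt0 // lnXn // -mulr_natl.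
  ring.
have lnX : ln (npack R n k * (lam / n%:R) ^+ (3 * k)) =
    ln (npack R n k) + (3 * k)%:R * ln (lam / n%:R).
  by rewrite lnM ?posrE ?exprn_gt0 // lnXn // mulr_natl.
have k3 : (3 * k)%:R / 3 = k%:R :> R by rewrite natrM; field.
have := ln_fact_ge R n; have := ln_fact_le R n.
have := ln_fact_ge R (n - 3 * k); have := ln_fact_le R (n - 3 * k).
have := ln_fact_ge R k; have := ln_fact_le R k.
have := ln_natr_le (leq_subr (3 * k) n).
have : ln (k%:R : R) <= ln (n%:R : R) by apply: ln_natr_le; lia.
rewrite -(lnK X0) !ler_expR lnX lnN /rate k3 natrB //.
lra.
Qed.

Definition target (n q : nat) : R :=
  (n ^_ q)%:R / ((3`!)%:R `^ (q%:R / 3) * rfact (q%:R / 3)) * (lam / n%:R) ^+ q.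

Lemma target_bounds (n q : nat) : (1 <= q <= n)%N ->
  expR (rate n%:R lam q%:R - 4 - 2 * ln n%:R) <= target n q <=
  expR (rate n%:R lam q%:R + 2 + ln n%:R).
Proof.
move=> /andP[q1 qn].
have n0 : (0 < n)%N by lia.
have n0' : 0 < n%:R :> R by rewrite ltr0n.
have n1 : 1 <= n%:R :> R by rewrite ler1n.
have q0' : 0 < q%:R :> R by rewrite ltr0n.
have p0 : 0 < lam / n%:R by rewrite divr_gt0.
have q3 : 0 < q%:R / 3 :> R by rewrite divr_gt0.
have q3n : q%:R / 3 <= n%:R :> R.
  have : q%:R <= n%:R :> R by rewrite ler_nat.
  lra.
have /andP[rl ru] := rfact_bounds q3.
have r0 : 0 < rfact (q%:R / 3 : R) by apply: lt_le_trans rl; exact: expR_gt0.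
have {}rl : ent (q%:R / 3 : R) - 1 <= ln (rfact (q%:R / 3 : R)) by rewrite -ler_expR lnK.
have x1 : 0 < q%:R / 3 + 1 :> R by lra.
have {}ru : ln (rfact (q%:R / 3 : R)) <= ent (q%:R / 3 : R) + 1 + (ln n%:R + 2).
  apply: (@le_trans _ _ (ln ((q%:R / 3 + 1) * expR (ent (q%:R / 3 : R) + 1)))).
    by rewrite ler_ln ?posrE // mulr_gt0 ?expR_gt0.
  rewrite lnM ?posrE ?expR_gt0 //.
  rewrite expRK addrC lerD2l; apply: ln_succ_le => //; lra.
have f0 : 0 < (n ^_ q)%:R :> R by rewrite ltr0n ffact_gt0.
have six : (3`!)%:R = 6 :> R by [].
have s0 : 0 < (3`!)%:R `^ (q%:R / 3) :> R by rewrite powR_gt0 // ltr0n.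
have T0 : 0 < target n q by rewrite mulr_gt0 ?exprn_gt0 // divr_gt0 // mulr_gt0.
have lnT : ln (target n q) = ln (n`!%:R : R) - ln ((n - q)`!%:R : R)
    - q%:R / 3 * ln 6 - ln (rfact (q%:R / 3 : R)) + q%:R * ln (lam / n%:R).
  rewrite /target [LHS]lnM ?posrE ?exprn_gt0 ?divr_gt0 ?mulr_gt0 //.
  rewrite [X in X + _ = _]ln_div ?posrE ?mulr_gt0 //.
  rewrite [X in _ - X + _ = _]lnM ?posrE // ln_powR six lnXn // ln_ffact //.
  by rewrite mulr_natl; ring.
have := ln_fact_ge R n; have := ln_fact_le R n.
have := ln_fact_ge R (n - q); have := ln_fact_le R (n - q).
have := ln_natr_le (leq_subr q n).
rewrite -(lnK T0) !ler_expR lnT /rate natrB //.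
lra.
Qed.

Definition probVT (n q : nat) : R :=
  Gnp_prob (lam / n%:R) (fun G : sgraph n => (q <= VT G)%N).

Lemma probVT_shift (n m i : nat) : (3 <= n)%N -> lam <= n%:R -> (m + i <= n)%N ->
  probVT n m <= expR ((6 * ln n%:R + ln (1 + lam ^- 3)) *+ i) * probVT n (m + i).
Proof.
move=> n3 ln_ ; have n0' : 0 < n%:R :> R by rewrite ltr0n; lia.
have p01 : 0 < lam / n%:R <= 1 by rewrite divr_gt0 //= ler_pdivrMr // mul1r.
have l3 : 0 < lam ^- 3 by rewrite invr_gt0 exprn_gt0.
have D : 1 + n%:R ^+ 3 / (lam / n%:R) ^+ 3 <= expR (6 * ln n%:R + ln (1 + lam ^- 3)).
  rewrite expRD lnK ?posrE ?addr_gt0 //.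
  rewrite (_ : 6 * ln n%:R = ln (n%:R ^+ 6)) ?lnXn ?mulr_natl // -lnXn // lnK ?posrE ?exprn_gt0 //.
  rewrite mulrDr mulr1; apply: lerD.
    by rewrite exprn_ege1 // ler1n; lia.
  rewrite expr_div_n invf_div mulrA -exprD lexx //.
elim: i => [|i IH] mi; first by rewrite mulr0n expR0 mul1r addn0.
apply: le_trans (IH _) _; first by lia.
rewrite [_ *+ i.+1]mulrSr expRD -mulrA ler_pM2l ?expR_gt0 // addnS.
apply: le_trans (VT_prob_succ p01 n3 _) _; first by lia.
by rewrite ler_wpM2r // Gnp_prob_ge0.
Qed.

(** In the upper bound the [(n + 1) ^ 2] pairs of sizes of the two families only
    contribute a polynomial factor. In the lower bound the packing has [q %/ 3]
    members, and at most two more vertices are added with [probVT_shift]. *)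
Lemma probVT_bounds : exists (K : R) (n0 : nat), forall n, (n0 <= n)%N ->
  1 <= ln (n%:R : R) /\ forall q, (q <= n)%N ->
  expR (rate n%:R lam q%:R - K * err n%:R) <= probVT n q <=
  expR (rate n%:R lam q%:R + K * err n%:R).
Proof.
pose C : R := lam ^+ 3 + 6 * lam ^+ 2.
have C0 : 0 < C by rewrite addr_gt0 ?mulr_gt0 ?exprn_gt0.
have [K1 [L0 [L01 rateP]]] := rate_bounds (ln C) lam0.
pose s := Num.bound (2 * C).
have sP : 2 * C <= s.+1%:R.
  have /ltW h : 2 * C < s%:R by apply: archi_boundP; lra.
  by apply: le_trans h _; rewrite ler_nat.
pose b1 : R := ln s.+1%:R; pose b2 : R := ln (1 + lam ^- 3).
have b10 : 0 <= b1 by rewrite ln_ge0 // ler1n.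
have b20 : 0 <= b2.
  by rewrite ln_ge0 // lerDl invr_ge0 exprn_ge0 // ltW.
pose K := K1 + 30 + s%:R + s%:R * b1 + 2 * b2.
exists K, (3 + (Num.bound lam + Num.bound (expR L0)))%N => n hn.
have n3 : (3 <= n)%N by lia.
have n_gt0 : (0 < n)%N by exact: leq_trans n3.
have n0' : 0 < n%:R :> R by rewrite ltr0n.
have n1 : 1 <= n%:R :> R by rewrite ler1n.
have lamn : lam <= n%:R.
  apply: (@le_trans _ _ (Num.bound lam)%:R); last by rewrite ler_nat; lia.
  by rewrite ltW // archi_boundP // ltW.
have L0n : L0 <= ln n%:R.
  rewrite -ler_expR lnK ?posrE //.
  apply: (@le_trans _ _ (Num.bound (expR L0))%:R); last by rewrite ler_nat; lia.
  by rewrite ltW // archi_boundP // ltW // expR_gt0.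
have lN : 1 <= ln (n%:R : R) by lra.
split=> // q qn.
have [_ _ LE E1] := err_bounds lN.
have [mono _ drop] := rateP _ L0n.
have p01 : 0 < lam / n%:R <= 1 by rewrite divr_gt0 //= ler_pdivrMr // mul1r.
have CE : extra_bound n (lam / n%:R) = C.
  by rewrite /extra_bound [n%:R * _]mulrC divfK ?gt_eqF.
have qn' : 0 <= (q%:R : R) <= n%:R by rewrite ler0n ler_nat.
have sb1 : 0 <= s%:R * b1 by rewrite mulr_ge0.
have sb1E : s%:R * b1 <= s%:R * b1 * err n%:R by rewrite ler_peMr.
have b2E : b2 <= b2 * err (n%:R : R) by rewrite ler_peMr.
have sLE : s%:R * ln (n%:R : R) <= s%:R * err (n%:R : R) by rewrite ler_wpM2l.
have sE0 : 0 <= s%:R * err (n%:R : R) by rewrite mulr_ge0 //; lra.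
have KE : K * err n%:R = K1 * err n%:R + 30 * err n%:R + s%:R * err n%:R
    + s%:R * b1 * err n%:R + 2 * (b2 * err n%:R) by rewrite /K; ring.
apply/andP; split; last first.
  pose M := rate n%:R lam q%:R + K1 * err n%:R + 1 + ln n%:R.
  apply: le_trans (VT_prob_le n p01 q) _.
  apply: (@le_trans _ _ (\sum_(kj : 'I_n.+1 * 'I_n.+1) expR M)).
    rewrite big_mkcond /=; apply: ler_sum => -[k j] _ /=.
    case: ifP => [/andP[qkj kn]|_]; last exact: expR_ge0.
    have /andP[_ hk] := npack_bounds n_gt0 kn.
    have hj : extra_bound n (lam / n%:R) ^+ j / j`!%:R <= expR (ln C * j%:R - ent j%:R).
      rewrite CE -[leLHS]lnK ?posrE ?divr_gt0 ?exprn_gt0 ?ltr0n ?fact_gt0 // ler_expR.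
      rewrite ln_div ?posrE ?exprn_gt0 ?ltr0n ?fact_gt0 // lnXn // mulr_natr.
      by rewrite lerD2l lerN2 ln_fact_ge.
    apply: (@le_trans _ _ (expR (rate n%:R lam (3 * k)%:R + 1 + ln n%:R) *
        expR (ln C * j%:R - ent j%:R))).
      apply: ler_pM => //.
      - by rewrite mulr_ge0 ?exprn_ge0 ?ler0n // ltW //; case/andP: p01.
      - by rewrite CE divr_ge0 ?exprn_ge0 // ltW.
    rewrite -expRD ler_expR /M.
    have x1 : 0 <= ((3 * k)%:R : R) <= n%:R by rewrite ler0n ler_nat.
    have z1 : (q%:R <= (3 * k)%:R + 2 * j%:R :> R) by rewrite -natrM -natrD ler_nat.
    have := drop _ _ _ x1 qn' (ler0n R j) z1; lra.
  rewrite sumr_const card_prod card_ord -[leLHS]mulr_natl.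
  have -> : (n.+1 * n.+1)%:R = expR (ln (n%:R + 1) + ln (n%:R + 1)) :> R.
    by rewrite expRD lnK ?posrE ?addr_gt0 // natrM -natr1.
  rewrite -expRD ler_expR /M.
  have := @ln_succ_le n%:R n%:R n1; rewrite ler0n lexx => /(_ isT); lra.
pose k := (q %/ 3)%N; pose r := (q %% 3)%N.
have qE : q = (3 * k + r)%N by rewrite mulnC -divn_eq.
have r3 : (r <= 2)%N by rewrite -ltnS ltn_mod.
have kq : (3 * k <= q)%N by rewrite mulnC leq_divM.
have kn : (3 * k <= n)%N by exact: leq_trans kq qn.
have := @probVT_shift n (3 * k) r n3 lamn; rewrite -qE -/b2 => /(_ qn) h1.
have hs : 2 * extra_bound n (lam / n%:R) <= s.+1%:R by rewrite CE.
have h2 := VT_prob_ge p01 hs kn; rewrite -/(probVT n (3 * k)) in h2.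
have /andP[h3 _] := npack_bounds n_gt0 kn.
have h4 : 2 * ((k + s) ^ s)%:R <= expR (2 + (ln n%:R + b1) * s%:R) :> R.
  rewrite expRD ler_pM //; first by have := expR_ge1Dx (2 : R); lra.
  rewrite natrX mulr_natr -lnM ?posrE ?ltr0n // -lnXn ?mulr_gt0 // lnK ?posrE ?exprn_gt0 ?mulr_gt0 //.
  rewrite lerXn2r ?nnegrE ?mulr_ge0 // -natrM ler_nat.
  rewrite mulnS leq_add //; first exact: leq_trans (leq_pmull _ _) kn.
  by rewrite leq_pmull //.
have h5 : (6 * ln n%:R + b2) *+ r <= 12 * ln n%:R + 2 * b2.
  rewrite -mulr_natl; have : r%:R <= 2 :> R by rewrite ler_nat.
  have L6 : 0 <= 6 * ln (n%:R : R) + b2 by lra.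
  by move=> /(ler_wpM2r L6); lra.
have P0 : 0 <= probVT n q by rewrite Gnp_prob_ge0.
have h6 : rate n%:R lam q%:R <= rate n%:R lam (3 * k)%:R + K1 * err n%:R.
  by apply: mono; [rewrite ler0n ler_nat | case/andP: qn'].
have h7 : expR (rate n%:R lam (3 * k)%:R - 2 - 2 * ln n%:R) <=
   expR (2 + (ln n%:R + b1) * s%:R) *
     (expR (12 * ln n%:R + 2 * b2) * probVT n q).
  apply: le_trans h3 (le_trans h2 _); apply: ler_pM => //.
  - exact: Gnp_prob_ge0.
  - by apply: le_trans h1 _; rewrite ler_wpM2r // ler_expR.
rewrite mulrA -expRD in h7.
rewrite -(ler_pM2l (expR_gt0 (2 + (ln n%:R + b1) * s%:R + (12 * ln n%:R + 2 * b2)))).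
by rewrite -expRD; apply: le_trans h7; rewrite ler_expR; lra.
Qed.

Lemma rateE (N a : R) : 1 <= N -> 0 < a < 1 ->
  rate N lam (a * N) =
    - N * (1 - a) * ln (1 - a) - 1 / 3 * (a * N) * ln (1 / 3 * (a * N))
    - a * N * (2 / 3 + 1 / 3 * ln 6) + a * N * ln lam.
Proof.
move=> N1 /andP[a0 a1]; have N0 : 0 < N by lra.
have a1' : 0 < 1 - a by lra.
have -> : 1 / 3 * (a * N) = a * N / 3 by field.
rewrite /rate /ent (_ : N - a * N = (1 - a) * N); last by ring.
have -> : ln ((1 - a) * N) = ln (1 - a) + ln N by rewrite lnM ?posrE.
have -> : ln (lam / N) = ln lam - ln N by rewrite ln_div ?posrE.
by field.
Qed.

End Estimates.

Theorem theorem2p1 (R : realType) (lambda : R) (lambda_gt0 : 0 < lambda) :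
  (forall q : nat -> nat,
    (forall n : nat, (0 < n)%N -> (1 <= q n <= n)%N) ->
    exists2 eps : nat -> R,
      eps =o_\oo (fun n : nat => n%:R `^ (19 / 20) : R) &
      \forall n \near \oo,
        Gnp_prob (lambda / n%:R) (fun G : sgraph n => (q n <= VT G)%N) =
          (n ^_ (q n))%:R
            / ((3`!)%:R `^ ((q n)%:R / 3) * rfact ((q n)%:R / 3))
          * (lambda / n%:R) ^+ q n * expR (eps n))
  /\
  (forall a : R, 0 < a < 1 ->
    (exists2 eps : nat -> R,
      eps =o_\oo (fun n : nat => n%:R `^ (19 / 20) : R) &
      \forall n \near \oo,
        0 < Gnp_prob (lambda / n%:R)
              (fun G : sgraph n => a * n%:R <= (VT G)%:R) /\
        ln (Gnp_prob (lambda / n%:R)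
              (fun G : sgraph n => a * n%:R <= (VT G)%:R)) =
          - n%:R * (1 - a) * ln (1 - a)
          - 1 / 3 * (a * n%:R) * ln (1 / 3 * (a * n%:R))
          - a * n%:R * (2 / 3 + 1 / 3 * ln 6)
          + a * n%:R * ln lambda + eps n)).
Proof.
have [K [n0 HK]] := probVT_bounds lambda_gt0.
split=> [q qP|a a01].
  have pos n : (n0 + 1 <= n)%N ->
      [/\ 0 < probVT lambda n (q n), 0 < target lambda n (q n) &
      `|ln (probVT lambda n (q n) / target lambda n (q n))| <= (K + 6) * err n%:R].
    move=> nn; have [|lN H] := HK n; first by apply: leq_trans nn; rewrite leq_addr.
    have qn : (1 <= q n <= n)%N by apply: qP; apply: leq_trans nn; rewrite ?/n1 addn1.
    have /andP[Pl Pu] := H (q n) (andP qn).2.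
    have /andP[Tl Tu] := target_bounds lambda_gt0 qn.
    have P0 : 0 < probVT lambda n (q n) by apply: lt_le_trans Pl; exact: expR_gt0.
    have T0 : 0 < target lambda n (q n) by apply: lt_le_trans Tl; exact: expR_gt0.
    split=> //; rewrite ln_div ?posrE //.
    move: Pl Pu Tl Tu; rewrite -[probVT _ _ _]lnK ?posrE // -[target _ _ _]lnK ?posrE //.
    rewrite !ler_expR !expRK => Pl Pu Tl Tu.
    have [_ _ LE E1] := err_bounds lN.
    by rewrite ler_norml; apply/andP; split; lra.
  exists (fun n => ln (probVT lambda n (q n) / target lambda n (q n))).
    by apply: (@err_littleo R _ (K + 6) (n0 + 1)) => n /pos[].
  near=> n.
  have [|P0 T0 _] := pos n; first by near: n; exact: nbhs_infty_ge.
  by rewrite lnK ?posrE ?divr_gt0 // -/(target lambda n (q n)) [RHS]mulrC divfK ?gt_eqF.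
have /andP[a0 a1] := a01.
have [K1 [L0 [_ rateP]]] := rate_bounds 0 lambda_gt0.
pose Pa n := Gnp_prob (lambda / n%:R) (fun G : sgraph n => a * n%:R <= (VT G)%:R).
pose n1 := (n0 + Num.bound (expR L0) + 1)%N.
have pos n : (n1 <= n)%N -> 0 < Pa n /\
    `|ln (Pa n) - rate n%:R lambda (a * n%:R)| <= (K + K1) * err n%:R.
  move=> nn; have [|lN H] := HK n; first by apply: leq_trans nn; rewrite /n1 -addnA leq_addr.
  have n_gt0 : (0 < n)%N by apply: leq_trans nn; rewrite ?/n1 addn1.
  have n0' : 0 < n%:R :> R by rewrite ltr0n.
  have L0n : L0 <= ln (n%:R : R).
    rewrite -ler_expR lnK ?posrE //.
    apply: (@le_trans _ _ (Num.bound (expR L0))%:R).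
      by rewrite ltW // archi_boundP // ltW // expR_gt0.
    by rewrite ler_nat; apply: leq_trans nn; rewrite /n1 addnAC leq_addl.
  have ex : exists m : nat, a * n%:R <= m%:R.
    by exists n; rewrite ler_piMl // ltW.
  (* [q] is the least integer above [a * n], so that the events agree. *)
  case: (ex_minnP ex) => q qa qmin.
  have qn : (q <= n)%N by apply: qmin; rewrite ler_piMl // ltW.
  have qa1 : q%:R - a * n%:R <= 1.
    case: (q) qa qmin => [_ _|m _ qmin].
      by have := mulr_ge0 (ltW a0) (ltW n0'); lra.
    have : ~~ (a * n%:R <= m%:R) by apply/negP => /qmin; rewrite ltnn.
    by rewrite -ltNge -natr1; lra.
  have PE : Pa n = probVT lambda n q.
    rewrite /Pa /probVT /Gnp_prob; apply: eq_bigl => G; apply/idP/idP => [/qmin //|qG].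
    by apply: le_trans qa _; rewrite ler_nat.
  have /andP[Pl Pu] := H q qn.
  have P0 : 0 < probVT lambda n q by apply: lt_le_trans Pl; exact: expR_gt0.
  rewrite PE; split=> //.
  move: Pl Pu; rewrite -[probVT _ _ _]lnK ?posrE // !ler_expR !expRK => Pl Pu.
  have [mono dec _] := rateP _ L0n.
  have anq : 0 <= a * n%:R <= q%:R by rewrite mulr_ge0 // ltW.
  have qn' : q%:R <= n%:R :> R by rewrite ler_nat.
  have h1 := mono _ _ anq qn'; have h2 := dec _ _ anq qn' qa1.
  by rewrite ler_norml; apply/andP; split; lra.
exists (fun n => ln (Pa n) - rate n%:R lambda (a * n%:R)).
  by apply: (@err_littleo R _ (K + K1) n1) => n /pos[].
near=> n.
have nn : (n1 <= n)%N by near: n; exact: nbhs_infty_ge.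
have [P0 _] := pos n nn.
rewrite -rateE //; first by split => //; rewrite addrC subrK.
by rewrite ler1n; apply: leq_trans nn; rewrite /n1 addn1.
Unshelve. all: by end_near. Qed.
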